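(* Let $\mathbb{K}$ be an algebraically closed field of characteristic zero, let $a\in\mathbb{K}^*$, let $m\ge 2$ be an integer, and let $D=aX\dfrac{\partial}{\partial X}+(amY+X^m)\dfrac{\partial}{\partial Y}$, a derivation of $\mathbb{K}[X,Y]$. Then \[ \operatorname{Aut}_D(\mathbb{K}[X,Y])=\{(\alpha X,\ \alpha^m Y+\beta X^m)\mid \alpha\in\mathbb{K}^*,\ \beta\in\mathbb{K}\}. \]
   Context: For a derivation $D$ of $\mathbb{K}[X,Y]$, $\operatorname{Aut}_D(\mathbb{K}[X,Y])$ denotes the isotropy group of $D$: the group of all $\mathbb{K}$-algebra automorphisms $\rho$ of $\mathbb{K}[X,Y]$ with $\rho D=D\rho$. A pair $(F,G)$ of polynomials denotes the $\mathbb{K}$-algebra endomorphism $\rho$ of $\mathbb{K}[X,Y]$ with $\rho(X)=F$ and $\rho(Y)=G$. *)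

(* Defs.v *)
From mathcomp Require Import all_boot all_algebra.
From mathcomp Require Import ring.
From mathcomp Require Export mpoly.

Set Implicit Arguments.
Unset Strict Implicit.
Unset Printing Implicit Defensive.

Import GRing.Theory.
Local Open Scope ring_scope.

Definition X {K : fieldType} : {mpoly K[2]} := 'X_ord0.
Definition Y {K : fieldType} : {mpoly K[2]} := 'X_ord_max.

Definition is_derivation (K : fieldType) (D : {mpoly K[2]} -> {mpoly K[2]}) :
    Prop :=
  linear D /\ forall p q, D (p * q) = D p * q + p * D q.

Definition is_automorphism (K : fieldType)
    (rho : {mpoly K[2]} -> {mpoly K[2]}) : Prop :=
  [/\ linear rho, monoid_morphism rho & bijective rho].

Definition isotropy (K : fieldType) (D rho : {mpoly K[2]} -> {mpoly K[2]}) :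
    Prop :=
  is_automorphism rho /\ rho \o D =1 D \o rho.

(* The K-algebra endomorphism written (F, G): substitution of F for X and of
   G for Y. *)
Definition endo (K : fieldType) (F G : {mpoly K[2]}) :
    {mpoly K[2]} -> {mpoly K[2]} :=
  comp_mpoly [tuple F; G].

Definition D (K : fieldType) (a : K) (m : nat) (p : {mpoly K[2]}) :
    {mpoly K[2]} :=
  (a *: X) * p^`M(ord0) + ((a * m%:R) *: Y + X ^+ m) * p^`M(ord_max).

Lemma endoX (K : fieldType) (F G : {mpoly K[2]}) : endo F G X = F.
Proof. by rewrite /endo /X comp_mpolyXU. Qed.

Lemma endoY (K : fieldType) (F G : {mpoly K[2]}) : endo F G Y = G.
Proof. by rewrite /endo /Y comp_mpolyXU. Qed.

Lemma D_derivation (K : fieldType) (a : K) (m : nat) : is_derivation (D a m).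
Proof.
rewrite /D; split=> [c p q | p q].
  by rewrite !linearP /= !mulrDr -!scalerAr scalerDr addrACA.
rewrite !mderivM; move: (a *: X) (_ + _ ^+ m) => u v; ring.
Qed.

(* Main.v *)
(* Give X weight 1 and Y weight m. The derivation D preserves weights, and on
   weight w it is a * w plus the locally nilpotent operator X^m d/dY; hence
   D - a * n is injective on every weight w <> n. If rho commutes with D, then
   D (rho X) = a (rho X) forces rho X to have weight 1, so rho X = alpha X, and
   then D (rho Y) = a m (rho Y) + alpha^m X^m forces rho Y to have weight m, so
   rho Y = gamma Y + beta X^m; substituting back gives gamma = alpha^m. *)
Require Import Defs.
From mathcomp Require Import all_boot all_algebra.
From mathcomp Require Import zify ring.

Set Implicit Arguments.
Unset Strict Implicit.
Unset Printing Implicit Defensive.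

Import GRing.Theory.
Local Open Scope ring_scope.

(** * Coefficients and induction for polynomials in two variables *)

Lemma mcoeffMX_if (n : nat) (R : nzRingType) (p : {mpoly R[n]})
    (e k : 'X_{1..n}) :
  (p * 'X_[e])@_k = if (e <= k)%MM then p@_(k - e) else 0.
Proof.
case: ifPn => [le_ek | nle_ek].
  by rewrite -{1}(submK le_ek) addmC mcoeffMX.
apply/eqP; rewrite mcoeff_eq0 (perm_mem (msuppMX p e)).
apply/mapP => -[l _ def_k]; case/negP: nle_ek.
by rewrite def_k lem_addr.
Qed.

Lemma submm (n : nat) (e : 'X_{1..n}) : (e - e = 0)%MM.
Proof. by rewrite -{1}[e]add0m addmK. Qed.

(** Serves to check identities between additive maps governed by a product rule on the generators
    only: uniqueness, cancellation and commutation below all come from it. *)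
Lemma mpoly2_ind (K : fieldType) (P : {mpoly K[2]} -> Prop) :
  (forall c, P c%:MP) -> P X -> P Y ->
  (forall p q, P p -> P q -> P (p + q)) ->
  (forall p q, P p -> P q -> P (p * q)) ->
  forall p, P p.
Proof.
move=> PC PX PY PD PM p.
have PXn i k : P ('X_i ^+ k).
  elim: k => [|k IHk]; first by rewrite expr0 -mpolyC1.
  rewrite exprS; apply: (PM) => //.
  by case: i {IHk} => -[|[|//]] lt_i2; [move: PX | move: PY];
     congr (P 'X_[U_(_)]); apply: val_inj.
rewrite [p]mpolyE; apply: (big_ind P) => [||e _] //; first by rewrite -mpolyC0.
rewrite -mul_mpolyC; apply: (PM) => //.
rewrite mpolyXE_id; apply: (big_ind P) => [|p1 p2|i _]; last exact: PXn.
  by rewrite -mpolyC1.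
exact: PM.
Qed.

(** * Substitution endomorphisms *)

Section Endo.

Variables (K : fieldType) (F G : {mpoly K[2]}).
Implicit Types p q : {mpoly K[2]}.

Lemma endoC c : endo F G c%:MP = c%:MP.
Proof. exact: comp_mpolyC. Qed.

Lemma endoZ c p : endo F G (c *: p) = c *: endo F G p.
Proof. exact: comp_mpolyZ. Qed.

Lemma endoD p q : endo F G (p + q) = endo F G p + endo F G q.
Proof. exact: comp_mpolyD. Qed.

Lemma endoN p : endo F G (- p) = - endo F G p.
Proof. exact: comp_mpolyN. Qed.

Lemma endoM p q : endo F G (p * q) = endo F G p * endo F G q.
Proof. by rewrite /endo rmorphM. Qed.

Lemma endo_Xn k : endo F G (X ^+ k) = F ^+ k.
Proof. by rewrite /endo rmorphXn /= -/(endo F G X) endoX. Qed.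

End Endo.

Lemma endo_unique (K : fieldType) (rho : {mpoly K[2]} -> {mpoly K[2]}) :
  linear rho -> monoid_morphism rho -> rho =1 endo (rho X) (rho Y).
Proof.
move=> rho_lin [rho1 rhoM].
have rhoD p q : rho (p + q) = rho p + rho q.
  by have := rho_lin 1 p q; rewrite !scale1r.
have rho0 : rho 0 = 0.
  by apply: (@addrI _ (rho 0)); rewrite -rhoD !addr0.
apply: mpoly2_ind => [c||| p q IHp IHq | p q IHp IHq].
- by rewrite endoC -alg_mpolyC -[_ *: _]addr0 rho_lin rho0 rho1.
- by rewrite endoX.
- by rewrite endoY.
- by rewrite rhoD IHp IHq endoD.
- by rewrite rhoM IHp IHq endoM.
Qed.

(** * Action of the derivation on generators, powers and coefficients *)

Lemma D_X (K : fieldType) (a : K) m : D a m X = a *: X.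
Proof.
rewrite /D /X !mderivX !mnm1E /= scale0r mulr0 addr0 submm.
by rewrite mpolyX0 scale1r mulr1.
Qed.

Lemma D_Y (K : fieldType) (a : K) m : D a m Y = (a * m%:R) *: Y + X ^+ m.
Proof.
rewrite /D /Y !mderivX !mnm1E /= scale0r mulr0 add0r submm.
by rewrite mpolyX0 scale1r mulr1.
Qed.

Lemma D_add (K : fieldType) (a : K) m p q : D a m (p + q) = D a m p + D a m q.
Proof. by have := (D_derivation a m).1 1 p q; rewrite !scale1r. Qed.

Lemma D_const (K : fieldType) (a : K) m c : D a m c%:MP = 0.
Proof. by rewrite /D !mderivC !mulr0 addr0. Qed.

Lemma D_scale (K : fieldType) (a : K) m c p : D a m (c *: p) = c *: D a m p.
Proof.
by rewrite -mul_mpolyC (D_derivation a m).2 D_const mul0r add0r mul_mpolyC.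
Qed.

Lemma D_Xn (K : fieldType) (a : K) m k : D a m (X ^+ k) = (a * k%:R) *: X ^+ k.
Proof.
elim: k => [|k IHk]; first by rewrite expr0 -mpolyC1 D_const mulr0 scale0r.
rewrite exprS (D_derivation a m).2 IHk D_X -scalerAr -scalerAl -scalerDl.
by rewrite -{1}[a]mulr1 -mulrDr -natr1 addrC.
Qed.

(** The Euler part [aX d/dX + amY d/dY] is diagonal on monomials, with eigenvalue [a] times the
    weight. The nilpotent part [X^m d/dY] feeds the monomial [e] from the one with [m] fewer [X] and
    one more [Y]. *)
Lemma mcoeff_D (K : fieldType) (a : K) m p (e : 'X_{1..2}) :
  (D a m p)@_e = a * (e ord0 + m * e ord_max)%:R * p@_e +
    if (m <= e ord0)%N then
      p@_(e - U_(ord0) *+ m + U_(ord_max)) *+ (e ord_max).+1 else 0.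
Proof.
have euler i : ('X_i * p^`M(i))@_e = (e i)%:R * p@_e.
  rewrite mulrC mcoeffMX_if.
  case: ifPn => [/mnm_lepP le_ie | nle_ie].
    rewrite mcoeff_deriv submK ?mnmBE ?mnm1E ?eqxx; last exact/mnm_lepP.
    have := le_ie i; rewrite mnm1E eqxx subn1 => /prednK ->.
    by rewrite mulr_natl.
  suff -> : e i = 0%N by rewrite mul0r.
  apply/eqP; apply: contraR nle_ie => ei_neq0; apply/mnm_lepP => j.
  by rewrite mnm1E; case: eqVneq => // <-; rewrite lt0n.
rewrite /D mulrDl -!scalerAl !mcoeffD !mcoeffZ !euler.
rewrite /X mpolyXn [_ * p^`M(_)]mulrC mcoeffMX_if.
have -> : (U_(ord0) *+ m <= e)%MM = (m <= e ord0)%N.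
  apply/mnm_lepP/idP => [/(_ ord0)|le_me [[|[|//]] lt_i2]].
  - by rewrite mulmnE mnm1E mul1n.
  - by rewrite mulmnE mnm1E mul1n (_ : Ordinal _ = ord0) //; apply: val_inj.
  - by rewrite mulmnE mnm1E.
rewrite addrA; congr (_ + _); first by rewrite natrD natrM; ring.
case: ifP => // _; rewrite mcoeff_deriv mnmBE mulmnE mnm1E.
by rewrite mul0n subn0.
Qed.

(** * Weights of solutions of the eigenvector equation *)

Lemma eqr_nat_char0 (K : fieldType) (charK0 : [pchar K] =i pred0) (i j : nat) :
  (i%:R == j%:R :> K) = (i == j).
Proof.
have natr_eq0 := (pcharf0P K).1 charK0.
wlog le_ji : i j / (j <= i)%N.
  by move=> IH; case/orP: (leq_total j i) => /IH //; rewrite eq_sym [RHS]eq_sym.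
by rewrite -subr_eq0 -natrB // natr_eq0 subn_eq0 eqn_leq le_ji andbT.
Qed.

(** Off weight [n], the coefficient at [e] of the equation reads [a * (w - n) * p@_e + t = 0], where
    [t] involves only a coefficient of the same weight [w] and smaller [X]-exponent; induction on
    that exponent kills [t], and characteristic zero makes [a * (w - n)] invertible. The term [q]
    allows for the inhomogeneous equation satisfied by [rho Y]. *)
Lemma eigen_weight (K : fieldType) (charK0 : [pchar K] =i pred0) (a : K)
    (a_neq0 : a != 0) m (m_gt0 : (0 < m)%N) n (p q : {mpoly K[2]}) :
  D a m p = (a * n%:R) *: p + q ->
  (forall e : 'X_{1..2}, (e ord0 + m * e ord_max != n)%N -> q@_e = 0) ->
  forall e : 'X_{1..2}, (e ord0 + m * e ord_max != n)%N -> p@_e = 0.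
Proof.
move=> Dp q_wt e; have [k] := ubnP (e ord0).
elim: k e => // k IHk e lt_ek wt_e.
have /(congr1 (mcoeff e)) := Dp.
rewrite mcoeff_D linearD /= mcoeffZ q_wt // addr0.
set t := (if _ then _ else _); suff -> : t = 0.
  rewrite addr0 => /eqP; rewrite -subr_eq0 -mulrBl mulf_eq0 -mulrBr mulf_eq0.
  rewrite (negPf a_neq0) /= subr_eq0 => /orP[|/eqP //].
  by rewrite (eqr_nat_char0 charK0) (negPf wt_e).
rewrite /t; case: ifP => // le_me; rewrite IHk ?mul0rn //.
  by rewrite mnmDE mnmBE mulmnE !mnm1E /=; lia.
by rewrite !mnmDE !mnmBE !mulmnE !mnm1E /=; lia.
Qed.

Lemma mnm2P (e f : 'X_{1..2}) :
  e ord0 = f ord0 -> e ord_max = f ord_max -> e = f.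
Proof.
move=> ef0 ef1; apply/mnmP => -[[|[|//]] lt_i2].
  by rewrite (_ : Ordinal _ = ord0) //; apply: val_inj.
by rewrite (_ : Ordinal _ = ord_max) //; apply: val_inj.
Qed.

(** Since [m >= 2], a factor [Y] already exceeds weight 1, so [X] is the only monomial of weight
    1. *)
Lemma weight1_scaleX (K : fieldType) m (m_ge2 : (2 <= m)%N) (p : {mpoly K[2]}) :
  (forall e : 'X_{1..2}, (e ord0 + m * e ord_max != 1)%N -> p@_e = 0) ->
  exists alpha, p = alpha *: X.
Proof.
move=> p_wt; exists p@_U_(ord0); apply/mpolyP => e.
rewrite mcoeffZ mcoeffX; case: eqVneq => [<- | e_neq]; first by rewrite mulr1.
rewrite mulr0 p_wt //; apply: contra_neq e_neq => wt_e.
have e1 : e ord_max = 0%N by nia.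
by apply: mnm2P; rewrite mnm1E /=; nia.
Qed.

(** The equation [i + m * j = m] has only the solutions [(0, 1)] and [(m, 0)]. *)
Lemma weightm_shape (K : fieldType) m (m_ge2 : (2 <= m)%N) (p : {mpoly K[2]}) :
  (forall e : 'X_{1..2}, (e ord0 + m * e ord_max != m)%N -> p@_e = 0) ->
  exists gamma beta, p = gamma *: Y + beta *: X ^+ m.
Proof.
move=> p_wt; exists p@_U_(ord_max), p@_(U_(ord0) *+ m); apply/mpolyP => e.
have neqYX : (U_(ord_max) == U_(ord0) *+ m :> 'X_{1..2})%MM = false.
  by apply/eqP => /mnmP /(_ ord_max); rewrite mulmnE !mnm1E.
rewrite linearD /= !mcoeffZ mcoeffXn mcoeffX.
case: eqVneq => [<- | e_neqY]; first by rewrite eq_sym neqYX mulr1 mulr0 addr0.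
case: eqVneq => [<- | e_neqX]; first by rewrite mulr0 mulr1 add0r.
rewrite !mulr0 addr0 p_wt //; apply/eqP => wt_e.
have [e1 | e1] : e ord_max = 0%N \/ e ord_max = 1%N by nia.
  by case/eqP: e_neqX; apply: mnm2P; rewrite mulmnE mnm1E /=; nia.
by case/eqP: e_neqY; apply: mnm2P; rewrite mnm1E /=; nia.
Qed.

(** * Cancellation and commutation checked on generators *)

Lemma endo_cancel (K : fieldType) (F G F' G' : {mpoly K[2]}) :
  endo F G F' = X -> endo F G G' = Y -> cancel (endo F' G') (endo F G).
Proof.
move=> eqX eqY; apply: mpoly2_ind => [c||| p q IHp IHq | p q IHp IHq].
- by rewrite !endoC.
- by rewrite endoX.
- by rewrite endoY.
- by rewrite !endoD IHp IHq.
- by rewrite !endoM IHp IHq.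
Qed.

Lemma endo_commute (K : fieldType) (a : K) m (F G : {mpoly K[2]}) :
  D a m F = endo F G (D a m X) -> D a m G = endo F G (D a m Y) ->
  endo F G \o D a m =1 D a m \o endo F G.
Proof.
move=> eqX eqY; apply: mpoly2_ind => [c||| p q | p q] /=.
- by rewrite D_const endoC D_const -mpolyC0 endoC.
- by rewrite -eqX endoX.
- by rewrite -eqY endoY.
- by rewrite !(endoD, D_add) => -> ->.
by rewrite !(endoM, (D_derivation a m).2, endoD) => -> ->.
Qed.

Theorem theorem3p5 (K : closedFieldType) (charK0 : [pchar K] =i pred0)
    (a : K) (a_neq0 : a != 0) (m : nat) (m_ge2 : (2 <= m)%N)
    (rho : {mpoly K[2]} -> {mpoly K[2]}) :
  isotropy (D a m) rho <->
  exists alpha beta : K,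
    alpha != 0 /\ rho =1 endo (alpha *: X) (alpha ^+ m *: Y + beta *: X ^+ m).
Proof.
have m_gt0 : (0 < m)%N by apply: ltnW.
have X_neq0 : X != 0 :> {mpoly K[2]}.
  apply/eqP => /(congr1 (mcoeff U_(ord0))) /eqP.
  by rewrite mcoeffXU mcoeff0 eqxx oner_eq0.
split.
- case=> -[rho_lin rho_mul rho_bij] rhoD.
  have rhoE := endo_unique rho_lin rho_mul.
  have DrhoX : D a m (rho X) = a *: rho X.
    by rewrite -[LHS]rhoD /= D_X rhoE endoZ endoX.
  have DrhoY : D a m (rho Y) = (a * m%:R) *: rho Y + rho X ^+ m.
    by rewrite -[LHS]rhoD /= D_Y rhoE endoD endoZ endoY endo_Xn.
  have [alpha rhoX] : exists alpha, rho X = alpha *: X.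
    apply: (weight1_scaleX m_ge2); apply: (eigen_weight charK0 a_neq0 m_gt0 (q := 0)).
      by rewrite DrhoX mulr1 addr0.
    by move=> e _; rewrite mcoeff0.
  have [gamma [beta rhoY]] :
      exists gamma beta, rho Y = gamma *: Y + beta *: X ^+ m.
    apply: (weightm_shape m_ge2); apply: (eigen_weight charK0 a_neq0 m_gt0 DrhoY).
    (* The inhomogeneous term is [alpha^m X^m], which has weight [m]. *)
    move=> e wt_e; rewrite rhoX exprZn mcoeffZ mcoeffXn.
    case: eqVneq => [def_e | _]; last by rewrite mulr0.
    by case/eqP: wt_e; rewrite -def_e !mulmnE !mnm1E mul1n mul0n muln0 addn0.
  exists alpha, beta; have alpha_neq0 : alpha != 0.
    (* If [alpha = 0], then [rho] sends both [X] and 0 to 0, against injectivity. *)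
    apply: contra_neq X_neq0 => alpha0; apply: (bij_inj rho_bij).
    by rewrite rhoX alpha0 scale0r rhoE -mpolyC0 endoC.
  split=> //; suff <- : gamma = alpha ^+ m by rewrite -rhoX -rhoY.
  (* The multiples of [a * m] cancel on both sides, leaving [gamma X^m = alpha^m X^m]. *)
  move: DrhoY; rewrite rhoX rhoY D_add !D_scale D_Y D_Xn exprZn.
  rewrite !scalerDr !scalerA [gamma * _]mulrC [beta * _]mulrC addrAC.
  move=> /addrI /eqP; rewrite -subr_eq0 -scalerBl
    scaler_eq0 subr_eq0 expf_eq0 (negPf X_neq0).
  by rewrite andbF orbF => /eqP.
case=> alpha [beta [alpha_neq0 rhoE]].
have am_neq0 : alpha ^+ m != 0 by rewrite expf_neq0.
split; last first.
  move=> p /=; rewrite !rhoE; apply: endo_commute.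
    by rewrite D_scale !D_X endoZ endoX !scalerA mulrC.
  rewrite [D a m Y]D_Y endoD endoZ endoY endo_Xn D_add !D_scale D_Y D_Xn.
  rewrite exprZn !scalerDr !scalerA.
  by rewrite addrAC [alpha ^+ m * _]mulrC [beta * _]mulrC.
split.
- by move=> c p q; rewrite !rhoE endoD endoZ.
- by split=> [|p q]; rewrite !rhoE ?endoM // -mpolyC1 endoC.
apply: (eq_bij _ (fsym rhoE)).
(* The inverse comes from solving [U = alpha X], [V = alpha^m Y + beta X^m] for [X] and [Y]. *)
exists (endo (alpha^-1 *: X)
             (alpha ^- m *: (Y - (beta * alpha ^- m) *: X ^+ m)));
  apply: endo_cancel.
- by rewrite endoZ endoX scalerA divff // scale1r.
- rewrite endoD !endoZ endoY endo_Xn exprZn exprVn !scalerA divff // scale1r.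
  by rewrite subrK.
- by rewrite endoZ endoX scalerA mulVf // scale1r.
rewrite endoZ endoD endoN endoZ endoY endo_Xn exprZn scalerA mulfVK //.
by rewrite addrK scalerA mulVf // scale1r.
Qed.
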